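(* Let $A$ be an $n\times n$ Hermitian matrix ($n\ge2$) with eigenvalues $\lambda_1\ge\dots\ge\lambda_n$ and corresponding orthonormal eigenvectors $v_1,\dots,v_n$, $v_{i,k}$ the $k$-th component of $v_i$. For $k=1,\dots,n$ let $\mu_{k,1}\ge\dots\ge\mu_{k,n-1}$ be the eigenvalues of $A_k$. Fix $1\le\ell\le r\le n-1$, let $U^k_\ell:=\sum_{i=\ell}^n|v_{i,k}|^2$, $L^k_{r+1}:=\sum_{i=1}^{r+1}|v_{i,k}|^2$, and assume $U^k_\ell\ne0$ and $L^k_{r+1}\ne0$ for all $k=1,\dots,n$. Define $\Omega_j(\ell):=\sum_{k=1}^n\frac{|v_{j,k}|^2}{U^k_\ell}$ and $\Psi_j(r):=\sum_{k=1}^n\frac{|v_{j,k}|^2}{L^k_{r+1}}$. Then $$n\sum_{j=\ell}^r\lambda_{j+1}+\sum_{j=\ell}^r(\lambda_\ell-\lambda_{j+1})\Psi_{j+1}(r)\le\sum_{k=1}^n\sum_{j=\ell}^r\mu_{k,j}\le n\sum_{j=\ell}^r\lambda_j-\sum_{j=\ell}^r(\lambda_j-\lambda_{r+1})\Omega_j(\ell).$$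
   Context: For an $n\times n$ matrix $A$ and $k\in\{1,\dots,n\}$, $A_k$ denotes the $(n-1)\times(n-1)$ principal submatrix obtained by deleting the $k$-th row and $k$-th column of $A$. *)

(* Defs.v *)
From HB Require Import structures.
From mathcomp Require Import all_boot all_order all_algebra.
Set Implicit Arguments. Unset Strict Implicit. Unset Printing Implicit Defensive.
Import Order.TTheory GRing.Theory Num.Theory.
Local Open Scope ring_scope.

(* 1-based access to data indexed by 'I_N.+1 (index i in 1..N.+1 maps to ordinal i-1). *)
Definition ev1 {C : Type} {N : nat} (lam : 'I_N.+1 -> C) (i : nat) : C :=
  lam (inord i.-1).

(* vc V i k = v_{i,k}: the k-th component of the i-th eigenvector, where the
   eigenvectors are the columns of V (1-based i, k). *)
Definition vc {C : Type} {N : nat} (V : 'M[C]_N.+1) (i k : nat) : C :=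
  V (inord k.-1) (inord i.-1).

Definition Uk {C : numClosedFieldType} {N : nat} (V : 'M[C]_N.+1) (l k : nat) : C :=
  \sum_(l <= i < N.+2) `|vc V i k| ^+ 2.

Definition Lk {C : numClosedFieldType} {N : nat} (V : 'M[C]_N.+1) (r k : nat) : C :=
  \sum_(1 <= i < r.+2) `|vc V i k| ^+ 2.

Definition Omega {C : numClosedFieldType} {N : nat} (V : 'M[C]_N.+1) (l j : nat) : C :=
  \sum_(1 <= k < N.+2) `|vc V j k| ^+ 2 / Uk V l k.

Definition Psi {C : numClosedFieldType} {N : nat} (V : 'M[C]_N.+1) (r j : nat) : C :=
  \sum_(1 <= k < N.+2) `|vc V j k| ^+ 2 / Lk V r k.

(* Main.v *)
(* For fixed k, choose a subspace Y of dimension r - l + 1, orthogonal to e_k,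
   spanned by combinations both of eigenvectors v_i of A with i >= l and of
   eigenvectors of A_k with index j <= r: the conditions to impose number
   (n - 1 - r) + (l - 1), so Y exists by counting dimensions. The trace of A
   compressed to Y is both sum_i lam_i p_i and sum_j mu_j q_j, where p_i and q_j
   are the squared norms of the projections of the eigenvectors to Y. Since
   q_j <= 1 and sum_j q_j = r - l + 1, the second sum is at least
   mu_l + ... + mu_r. Since Y is orthogonal to the projection of e_k to
   span(v_l, ..., v_n), Bessel's inequality gives p_i <= 1 - |v_{i,k}|^2 / U_l^k,
   which bounds the first sum from above. The lower bound is the same argument
   with the indices i <= r + 1 and j >= l. *)
Require Import Defs.
From HB Require Import structures.
From mathcomp Require Import all_boot all_order all_algebra all_fingroup zify.
Import Order.TTheory GRing.Theory Num.Theory.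
Local Open Scope ring_scope.
Local Open Scope sesquilinear_scope.

(** * Weighted sums under a bound on each weight *)

Section Weighted.
Variables (C : numClosedFieldType) (I : finType) (T : {set I}).
Variables (x p t : I -> C) (c : C).
Hypothesis p_ge0 : forall i, 0 <= p i.
Hypothesis p_le : forall i, i \in T -> p i <= 1 - t i.
Hypothesis sum_p : \sum_i p i = #|T|%:R.

(** The weights add up to the size of [T], so replacing [x] by [x - c] changes both sides by the
    same amount. Then the terms in [T] have a nonnegative factor [x i - c] and the bound [1 - t i]
    applies to them, while the terms outside [T] are at most zero. *)
Lemma weighted_sum_le :
    (forall i, i \in T -> c <= x i) ->
    (forall i, i \notin T -> p i = 0 \/ x i <= c) ->
  \sum_i x i * p i <= \sum_(i in T) x i - \sum_(i in T) (x i - c) * t i.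
Proof.
move=> xT xTC.
have -> : \sum_i x i * p i = \sum_i (x i - c) * p i + c * #|T|%:R.
  rewrite -sum_p mulr_sumr -big_split /=; apply: eq_bigr => i _.
  by rewrite mulrBl subrK.
have -> : \sum_(i in T) x i - \sum_(i in T) (x i - c) * t i
          = \sum_(i in T) (x i - c) * (1 - t i) + c * #|T|%:R.
  rewrite -sum1_card natr_sum mulr_sumr -big_split -sumrB /=.
  by apply: eq_bigr => i _; rewrite mulr1 mulrBr mulr1 addrAC subrK.
rewrite lerD2r (bigID (mem T)) /= -[leRHS]addr0; apply: lerD.
  by apply: ler_sum => i iT; rewrite ler_wpM2l ?p_le // subr_ge0 xT.
apply: sumr_le0 => i iT; case: (xTC i iT) => [->|xc]; first by rewrite mulr0.
by rewrite mulr_le0_ge0 ?subr_le0.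
Qed.

End Weighted.

(** Mirror image of the upper bound, obtained by negating [x] and [c]. *)
Lemma weighted_sum_ge (C : numClosedFieldType) (I : finType) (T : {set I})
    (x p t : I -> C) (c : C) :
    (forall i, 0 <= p i) -> (forall i, i \in T -> p i <= 1 - t i) ->
    \sum_i p i = #|T|%:R ->
    (forall i, i \in T -> x i <= c) ->
    (forall i, i \notin T -> p i = 0 \/ c <= x i) ->
  \sum_(i in T) x i + \sum_(i in T) (c - x i) * t i <= \sum_i x i * p i.
Proof.
move=> p0 pt sp xT xTC; rewrite -lerN2 opprD -!sumrN.
have -> : \sum_i - (x i * p i) = \sum_i (- x i) * p i.
  by apply: eq_bigr => i _; rewrite mulNr.
apply: le_trans (@weighted_sum_le _ _ T (fun i => - x i) p t (- c) p0 pt sp _ _) _.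
- by move=> i iT; rewrite lerN2 xT.
- by move=> i /xTC [|?]; [left | right; rewrite lerN2].
rewrite -sumrN lerD2l le_eqVlt; apply/orP; left; apply/eqP.
by apply: eq_bigr => i _; rewrite opprK [- x i + c]addrC.
Qed.

(** * Matrices with orthonormal rows *)

Section UnitaryRows.
Context {C : numClosedFieldType}.

(** When the rows of [G] are orthonormal, this is the [i]-th diagonal entry of the orthogonal
    projection [G ^t* *m G]. *)
Definition col_sqnorm {d n} (G : 'M[C]_(d, n)) (i : 'I_n) : C :=
  \sum_a `|G a i| ^+ 2.

Lemma col_sqnorm_ge0 d n (G : 'M[C]_(d, n)) i : 0 <= col_sqnorm G i.
Proof. by apply: sumr_ge0 => a _; rewrite exprn_ge0. Qed.

Lemma sum_col_sqnorm d n (G : 'M[C]_(d, n)) :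
  G \is unitarymx -> \sum_i col_sqnorm G i = d%:R.
Proof.
move=> /unitarymxP GG; rewrite exchange_big /= -mxtrace1 -GG; apply: eq_bigr => a _; rewrite mxE.
by apply: eq_bigr => i _; rewrite !mxE normCK.
Qed.

Lemma trace_diag_conj d n (G : 'M[C]_(d, n)) (x : 'rV[C]_n) :
  \tr (G *m diag_mx x *m G ^t*) = \sum_i x 0 i * col_sqnorm G i.
Proof.
rewrite /mxtrace; under eq_bigr do rewrite mxE.
rewrite exchange_big /=; apply: eq_bigr => i _; rewrite mulr_sumr.
apply: eq_bigr => a _.
by rewrite mul_mx_diag !mxE normCK mulrAC mulrC.
Qed.

(** The projection [P = G ^t* *m G] satisfies [P *m P ^t* = P], so its diagonal entry at [i] is the
    squared norm of its row [i]. Hence that entry is at least its own square, and so at most 1. *)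
Lemma col_sqnorm_le1 d n (G : 'M[C]_(d, n)) i :
  G \is unitarymx -> col_sqnorm G i <= 1.
Proof.
move=> /unitarymxP GG; pose P := G ^t* *m G.
have Pii : P i i = col_sqnorm G i.
  by rewrite mxE; apply: eq_bigr => a _; rewrite !mxE normCK mulrC.
have PP : P *m P ^t* = P.
  by rewrite /P trmx_mul map_mxM trmxCK !mulmxA -[_ *m _ *m G ^t*]mulmxA GG mulmx1.
have : col_sqnorm G i ^+ 2 <= col_sqnorm G i.
  rewrite -{2}Pii -PP mxE (bigD1 i) //= [in X in _ <= _ * X + _]mxE [in X in _ <= _ * X + _]mxE -normCK.
  rewrite Pii ger0_norm ?col_sqnorm_ge0 // lerDl.
  by apply: sumr_ge0 => j _; rewrite !mxE mul_conjC_ge0.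
have := col_sqnorm_ge0 _ _ G i; rewrite le_eqVlt => /predU1P[<-|p0].
  by rewrite ler01.
by rewrite expr2 -ler_pdivlMr // divff ?gt_eqF.
Qed.

End UnitaryRows.

(** * Diagonalization and orthonormal families in a kernel *)

Section Compression.
Context {C : numClosedFieldType}.

Lemma char_poly_conj n (P B : 'M[C]_n) :
  P \in unitmx -> char_poly (invmx P *m B *m P) = char_poly B.
Proof.
move=> Pu; rewrite /char_poly /char_poly_mx.
pose Q := map_mx polyC P; pose Q' := map_mx polyC (invmx P).
have QQ : Q' *m Q = 1%:M by rewrite -map_mxM mulVmx // map_mx1.
have -> : 'X%:M - map_mx polyC (invmx P *m B *m P)
          = Q' *m ('X%:M - map_mx polyC B) *m Q.
  by rewrite mulmxBr mulmxBl !map_mxM scalar_mxC -[_ *m Q' *m Q]mulmxA QQ mulmx1.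
by rewrite !det_mulmx mulrAC -det_mulmx QQ det1 mul1r.
Qed.

(** The spectral theorem yields the eigenvalues in an uncontrolled order. Factoring the
    characteristic polynomial into linear factors shows that [mu] is a permutation [u] of them, and
    permuting the rows of the spectral matrix by [u] restores the prescribed order. *)
Lemma hermitian_diagonalization n (B : 'M[C]_n) (mu : 'I_n -> C) :
    B \is hermsymmx -> char_poly B = \prod_(j < n) ('X - (mu j)%:P) ->
  exists2 D : 'M[C]_n,
    D \is unitarymx & B = D ^t* *m diag_mx (\row_j mu j) *m D.
Proof.
move=> /hermitian_normalmx/orthomx_spectralP; set P := spectralmx B.
set s := spectral_diag B => BE charB.
have Pu : P \is unitarymx by apply: spectral_unitarymx.
have : char_poly B = \prod_(j < n) ('X - (s 0 j)%:P).
  rewrite BE char_poly_conj ?unitarymx_unit // char_poly_trig ?diag_mx_is_trig //.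
  by apply: eq_bigr => i _; rewrite mxE eqxx.
rewrite charB => Ems.
have /tuple_permP[u us] : perm_eq [tuple mu j | j < n] [tuple s 0 j | j < n].
  apply: prod_XsubC_eq; rewrite !big_tuple.
  under eq_bigr do rewrite tnth_mktuple.
  by under [RHS]eq_bigr do rewrite tnth_mktuple.
have mus j : mu j = s 0 (u j).
  have /val_inj/(congr1 (fun t => tnth t j)) := us.
  by rewrite !tnth_mktuple.
exists (row_perm u P).
  apply/unitarymxP; rewrite -[RHS](unitarymxP (_ : perm_mx u *m P \is unitarymx)) ?row_permE //.
  apply: mul_unitarymx => //; apply/unitarymxP.
  by rewrite tr_perm_mx map_perm_mx -perm_mxM mulgV perm_mx1.
rewrite BE invmx_unitary // !mul_mx_diag; apply/matrixP => i j; rewrite !mxE.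
by rewrite (reindex_perm u) /=; apply: eq_bigr => a _; rewrite !mxE mus.
Qed.

End Compression.

(** The left kernel of [K] has dimension at least [n - q], hence at least [d]; the first [d] rows of
    a Gram-Schmidt basis of it serve as [W]. *)
Lemma unitarymx_in_ker (C : numClosedFieldType) n q d (K : 'M[C]_(n, q)) :
  (d + q <= n)%N -> exists2 W : 'M[C]_(d, n), W \is unitarymx & W *m K = 0.
Proof.
move=> dq; pose S := schmidt (row_base (kermx K)).
have dr : (d <= \rank (kermx K))%N.
  by rewrite mxrank_ker; have := rank_leq_col K; lia.
have Su : S \is unitarymx by rewrite schmidt_unitarymx ?rank_leq_col.
have SK : S *m K = 0.
  by apply/sub_kermxP; rewrite eqmx_schmidt_free ?row_base_free ?eq_row_base.
exists (rowsub (widen_ord dr) S); last first.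
  by rewrite mul_rowsub_mx SK; apply/matrixP => i j; rewrite !mxE.
apply/unitarymxP/matrixP => i j; have /unitarymxP/matrixP := Su.
move/(_ (widen_ord dr i) (widen_ord dr j)); rewrite !mxE => <-.
by apply: eq_bigr => a _; rewrite !mxE.
Qed.

(** * A subspace adapted to both a matrix and its principal submatrix *)

Section PrincipalSubmatrix.
Variables (C : numClosedFieldType) (n : nat) (A V : 'M[C]_n.+1).
Variables (lam : 'I_n.+1 -> C) (mu : 'I_n -> C) (k : 'I_n.+1).
Hypothesis A_herm : A \is hermsymmx.
Hypothesis V_unitary : V ^t* *m V = 1%:M.
Hypothesis V_eigen : forall i, A *m col i V = lam i *: col i V.
Hypothesis mu_char :
  char_poly (row' k (col' k A)) = \prod_(j < n) ('X - (mu j)%:P).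

(** Deleting entry [k] as a matrix product: [E] has orthonormal rows and compresses [A] to its
    principal submatrix. *)
Let E : 'M[C]_(n, n.+1) := row' k 1%:M.

Let V_unitary' : V *m V ^t* = 1%:M. Proof. exact: mulmx1C. Qed.

Let E_row i j : E i j = (lift k i == j)%:R. Proof. by rewrite !mxE. Qed.

Let E_adj : E ^t* = col' k 1%:M.
Proof. by apply/matrixP => i j; rewrite !mxE rmorph_nat eq_sym. Qed.

Let EE : E *m E ^t* = 1%:M.
Proof.
rewrite E_adj /E row'Esub col'Esub -mxsub_mul mul1mx.
by apply/matrixP => i j; rewrite !mxE (inj_eq lift_inj).
Qed.

Let A_spectral : A = V *m diag_mx (\row_i lam i) *m V ^t*.
Proof.
suff -> : V *m diag_mx (\row_i lam i) = A *m V by rewrite -mulmxA V_unitary' mulmx1.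
apply/matrixP => i j; have /matrixP/(_ i 0) := V_eigen j.
rewrite mul_mx_diag !mxE mulrC => <-.
by apply: eq_bigr => a _; rewrite !mxE.
Qed.

Let submx_herm : row' k (col' k A) \is hermsymmx.
Proof.
apply/is_hermitianmxP; have /is_hermitianmxP := A_herm.
rewrite !expr0 !scale1r => AE; apply/matrixP => i j.
by rewrite !mxE [in LHS]AE !mxE.
Qed.

Let submx_compress : row' k (col' k A) = E *m A *m E ^t*.
Proof.
rewrite E_adj /E row'Esub col'Esub mul_rowsub_mx mul1mx -mxsub_mul mulmx1.
by apply/matrixP => i j; rewrite !mxE.
Qed.

Variables (I : {set 'I_n.+1}) (J : {set 'I_n}) (d : nat).
Hypothesis card_IJ : (d + #|~: I| = #|J|)%N.
Let U := \sum_(i in I) `|V k i| ^+ 2.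
Hypothesis U_neq0 : U != 0.

(** One linear condition is imposed for each index outside [I] or outside [J]; by [card_IJ] these
    number [n - d], which leaves a space of dimension at least [d]. *)
Lemma common_compression_weights :
  exists p : 'I_n.+1 -> C, exists q : 'I_n -> C,
  [/\ \sum_i lam i * p i = \sum_j mu j * q j,
      [/\ forall i, 0 <= p i, \sum_i p i = d%:R, forall i, i \notin I -> p i = 0
        & forall i, i \in I -> p i <= 1 - `|V k i| ^+ 2 / U]
    & [/\ forall j, 0 <= q j, \sum_j q j = d%:R, forall j, j \notin J -> q j = 0
        & forall j, q j <= 1]].
Proof.
have [D Du AkE] := hermitian_diagonalization _ _ _ submx_herm mu_char.
(* The columns of [K] are the eigenvectors of the submatrix outside [J], and those of [A] outside
   [I] with entry [k] deleted. *)
pose K := row_mx (colsub (enum_val : 'I_#|~: J| -> 'I_n) (D ^t*))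
                 (colsub (enum_val : 'I_#|~: I| -> 'I_n.+1) (E *m V)).
have [|W Wu] := @unitarymx_in_ker C n _ d K.
  by have := cardsC J; rewrite card_ord; lia.
rewrite mul_mx_row => WK.
have [WD0 WV0] : W *m colsub (enum_val : 'I_#|~: J| -> 'I_n) (D ^t*) = 0 /\
    W *m colsub (enum_val : 'I_#|~: I| -> 'I_n.+1) (E *m V) = 0.
  by apply/eq_row_mx; rewrite WK row_mx0.
(* The same orthonormal family in coordinates of the two eigenbases: the squared column norms of [G]
   and [F] will be the weights [p] and [q]. *)
pose F := W *m D ^t*; pose G := W *m (E *m V).
have Fu : F \is unitarymx by rewrite mul_unitarymx ?trmxC_unitary.
have Gu : G \is unitarymx.
  by rewrite !mul_unitarymx //; apply/unitarymxP.
have F0 a j : j \notin J -> F a j = 0.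
  move=> jJ; have jC : j \in ~: J by rewrite inE.
  have /matrixP/(_ a (enum_rank_in jC j)) := WD0.
  by rewrite mulmx_colsub !mxE enum_rankK_in.
have G0 a i : i \notin I -> G a i = 0.
  move=> iI; have iC : i \in ~: I by rewrite inE.
  have /matrixP/(_ a (enum_rank_in iC i)) := WV0.
  by rewrite mulmx_colsub !mxE enum_rankK_in // => <-; rewrite mxE.
(* Going back from eigenbasis coordinates, [G *m V ^t*] is [W *m E], whose column [k] is zero. *)
have Vk0 a : \sum_i G a i * (V k i)^* = 0.
  have -> : \sum_i G a i * (V k i)^* = (G *m V ^t*) a k.
    by rewrite [RHS]mxE; apply: eq_bigr => i _; congr (_ * _); rewrite !mxE.
  rewrite /G -!mulmxA V_unitary' mulmx1 mxE; apply: big1 => i _.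
  by rewrite E_row eq_sym (negPf (neq_lift _ _)) mulr0.
have U_gt0 : 0 < U.
  by rewrite lt_def U_neq0 sumr_ge0 // => i _; rewrite exprn_ge0.
(* Appending the normalised restriction of row k of V to I keeps G unitary. *)
pose e : 'rV[C]_n.+1 := \row_i (if i \in I then V k i / sqrtC U else 0).
have sU : (sqrtC U)^* = sqrtC U by rewrite geC0_conj // sqrtC_ge0 ltW.
have norm_e i : i \in I -> `|e 0 i| ^+ 2 = `|V k i| ^+ 2 / U.
  move=> iI; rewrite mxE iI normf_div expr_div_n.
  by rewrite [`|sqrtC U|]ger0_norm ?sqrtC_ge0 ?ltW // sqrtCK.
have ee : e *m e ^t* = 1%:M.
  apply/matrixP => i j; rewrite !ord1 mxE [RHS]mxE /= (bigID (mem I)) /=.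
  rewrite [X in _ + X]big1 ?addr0 => [|i' iI]; last by rewrite !mxE (negPf iI) mul0r.
  rewrite (eq_bigr (fun i => `|V k i| ^+ 2 / U)) => [|i' iI].
    by rewrite -mulr_suml divff.
  by rewrite -norm_e // normCK !mxE.
(* Cutting row [k] of [V] down to [I] does not change the product, as [G] vanishes outside [I]. *)
have Ge : G *m e ^t* = 0.
  apply/matrixP => a j; rewrite ord1 mxE [RHS]mxE.
  rewrite (eq_bigr (fun i => G a i * (V k i)^* / sqrtC U)) => [|i _].
    by rewrite -mulr_suml Vk0 mul0r.
  case: (boolP (i \in I)) => iI; last by rewrite G0 // !mul0r.
  rewrite -mulrA; congr (_ * _); rewrite !mxE iI.
  by rewrite rmorphM fmorphV /= sU.
have Hu : col_mx G e \is unitarymx.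
  apply/unitarymxP; rewrite tr_col_mx map_row_mx mul_col_row ee Ge.
  rewrite (unitarymxP Gu) -[e *m _]trmxCK trmx_mul map_mxM trmxCK Ge.
  by rewrite trmx0 map_mx0 -scalar_mx_block.
exists (col_sqnorm G), (col_sqnorm F); split; last first.
- split; rewrite ?sum_col_sqnorm // => j; rewrite ?col_sqnorm_ge0 ?col_sqnorm_le1 //.
  by move=> jJ; apply: big1 => a _; rewrite F0 // normr0 expr0n.
- split; rewrite ?sum_col_sqnorm // => i; rewrite ?col_sqnorm_ge0 // => iI.
    by apply: big1 => a _; rewrite G0 // normr0 expr0n.
  (* Column [i] of the extended matrix has squared norm [p i] plus [|V k i|^2 / U]. *)
  have := col_sqnorm_le1 _ _ _ i Hu.
  rewrite /col_sqnorm big_split_ord big_ord1 /= col_mxEd norm_e // -lerBrDr.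
  by under eq_bigr do rewrite col_mxEu.
(* One trace is computed twice, once through the spectral form of [A] and once through that of the
   submatrix. *)
have := erefl (\tr (W *m row' k (col' k A) *m W ^t*)).
rewrite {1}submx_compress {1}A_spectral AkE.
have -> : W *m (E *m (V *m diag_mx (\row_i lam i) *m V ^t*) *m E ^t*) *m W ^t*
        = G *m diag_mx (\row_i lam i) *m G ^t*.
  by rewrite /G !trmx_mul !map_mxM !mulmxA.
have -> : W *m (D ^t* *m diag_mx (\row_j mu j) *m D) *m W ^t*
        = F *m diag_mx (\row_j mu j) *m F ^t*.
  by rewrite /F !trmx_mul !map_mxM trmxCK !mulmxA.
rewrite !trace_diag_conj; under eq_bigr do rewrite mxE.
by under [RHS]eq_bigr do rewrite mxE.
Qed.

End PrincipalSubmatrix.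

(** * One-based ranges as sets of ordinals *)

Lemma big_inord_pred (R : Type) (idx : R) (op : Monoid.law idx) (N a b : nat)
    (F : 'I_N.+1 -> R) :
    (0 < a)%N -> (b <= N.+1)%N ->
  \big[op/idx]_(a <= j < b.+1) F (inord j.-1)
    = \big[op/idx]_(i in [set i : 'I_N.+1 | a <= i.+1 <= b]%N) F i.
Proof.
case: a => // a _ bN; rewrite big_add1 /= big_geq_mkord.
rewrite (big_ord_widen_cond _ (fun i => a <= i)%N (fun i => F (inord i)) bN).
by apply: eq_big => [i|i _]; rewrite ?inE ?ltnS //= inord_val.
Qed.

Lemma card_ord_range (N a b : nat) :
    (0 < a)%N -> (b <= N.+1)%N ->
  #|[set i : 'I_N.+1 | a <= i.+1 <= b]%N| = (b.+1 - a)%N.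
Proof.
by move=> a0 bN; rewrite -sum1_card -big_inord_pred // sum_nat_const_nat muln1.
Qed.

(** * The two bounds for a single deleted index *)

Section EigenvalueSums.
Context {C : numClosedFieldType} {m : nat}.
Variables (A V : 'M[C]_m.+2) (lam : 'I_m.+2 -> C) (mu : 'I_m.+1 -> C).
Variables (k : 'I_m.+2) (l r : nat).
Hypothesis A_herm : A \is hermsymmx.
Hypothesis V_unitary : V ^t* *m V = 1%:M.
Hypothesis V_eigen : forall i, A *m col i V = lam i *: col i V.
Hypothesis lam_noninc : forall i j : 'I_m.+2, (i <= j)%N -> lam j <= lam i.
Hypothesis mu_char :
  char_poly (row' k (col' k A)) = \prod_(j < m.+1) ('X - (mu j)%:P).
Hypothesis mu_noninc : forall i j : 'I_m.+1, (i <= j)%N -> mu j <= mu i.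
Hypotheses (l_gt0 : (1 <= l)%N) (le_lr : (l <= r)%N) (le_rm : (r <= m.+1)%N).

Let ev1_noninc N (x : 'I_N.+1 -> C) (a : nat) (i : 'I_N.+1) :
  (forall i j : 'I_N.+1, (i <= j)%N -> x j <= x i) ->
  (0 < a <= N.+1)%N ->
  ((a <= i.+1)%N -> x i <= ev1 x a) /\ ((i.+1 <= a)%N -> ev1 x a <= x i).
Proof.
move=> xN aN; have aE : nat_of_ord (inord a.-1 : 'I_N.+1) = a.-1 by rewrite inordK; lia.
by split=> ai; apply: xN; rewrite aE; lia.
Qed.

Lemma submx_eigenvalue_sum_le :
    Uk V l k.+1 != 0 ->
  \sum_(l <= j < r.+1) ev1 mu j
    <= \sum_(l <= j < r.+1) ev1 lam j
       - \sum_(l <= j < r.+1) (ev1 lam j - ev1 lam r.+1)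
           * (`|vc V j k.+1| ^+ 2 / Uk V l k.+1).
Proof.
rewrite /Uk /vc /= inord_val.
rewrite (big_inord_pred _ _ _ _ _ _ (fun i => `|V k i| ^+ 2)) // => U_neq0.
rewrite (big_inord_pred _ _ _ _ _ _ mu) // (big_inord_pred _ _ _ _ _ _ lam) //; last lia.
rewrite (big_inord_pred _ _ _ _ _ _
  (fun i => (lam i - ev1 lam r.+1) * (`|V k i| ^+ 2 / _))) //; last lia.
set I := [set i | _] in U_neq0 *.
set TJ := [set i : 'I_m.+1 | _]; set T := [set i : 'I_m.+2 | _].
set J := [set j : 'I_m.+1 | 1 <= j.+1 <= r]%N.
have cTJ : #|TJ| = (r.+1 - l)%N by rewrite card_ord_range.
have cT : #|T| = (r.+1 - l)%N by rewrite card_ord_range //; lia.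
have cIJ : ((r.+1 - l) + #|~: I| = #|J|)%N.
  by have := cardsC I; rewrite card_ord !card_ord_range //; lia.
have [p [q [pq [p0 sp pI p1] [q0 sq qJ q1]]]] :=
  common_compression_weights _ _ _ _ _ _ _ A_herm V_unitary V_eigen mu_char _ _ _ cIJ U_neq0.
(* The threshold is [mu_l]: indices before [l] carry values at least [mu_l], and indices after [r]
   carry no weight. *)
have muq : \sum_(j in TJ) mu j <= \sum_j mu j * q j.
  have := weighted_sum_ge _ _ TJ mu q (fun=> 0) (ev1 mu l) q0.
  rewrite -mulr_suml mulr0 addr0; apply=> [j _||j|j].
  - by rewrite subr0.
  - by rewrite cTJ.
  - rewrite inE => jT; apply: (ev1_noninc _ _ _ _ mu_noninc _).1; lia.
  - rewrite inE => jT; case: (boolP (j \in J)) => [|/qJ]; last by left.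
    rewrite inE => jJ; right; apply: (ev1_noninc _ _ _ _ mu_noninc _).2; lia.
apply: le_trans muq _; rewrite -pq.
(* Here the threshold is [lam_(r+1)]: indices before [l] carry no weight, and those after [r] carry
   values at most [lam_(r+1)]. *)
apply: (weighted_sum_le _ _ T lam p _ _ p0) => [i||i|i].
- by rewrite inE => iT; apply: p1; rewrite inE; have := ltn_ord i; lia.
- by rewrite cT.
- rewrite inE => iT; apply: (ev1_noninc _ _ _ _ lam_noninc _).2; lia.
- rewrite inE => iT; case: (boolP (i \in I)) => [|/pI]; last by left.
  rewrite inE => iI; right; apply: (ev1_noninc _ _ _ _ lam_noninc _).1; lia.
Qed.

Lemma submx_eigenvalue_sum_ge :
    Lk V r k.+1 != 0 ->
  \sum_(l <= j < r.+1) ev1 lam j.+1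
    + \sum_(l <= j < r.+1) (ev1 lam l - ev1 lam j.+1)
        * (`|vc V j.+1 k.+1| ^+ 2 / Lk V r k.+1)
  <= \sum_(l <= j < r.+1) ev1 mu j.
Proof.
(* Reindexing makes [T] the range from [l+1] to [r+1], which lies inside the range [I] from 1 to
   [r+1]. *)
have shift (F : nat -> C) :
  \sum_(l <= j < r.+1) F j.+1 = \sum_(l.+1 <= j < r.+2) F j by rewrite big_add1.
rewrite (shift (ev1 lam)) (shift (fun j => (ev1 lam l - ev1 lam j)
  * (`|vc V j k.+1| ^+ 2 / Lk V r k.+1))) /=.
rewrite /Lk /vc /= inord_val.
rewrite (big_inord_pred _ _ _ _ _ _ (fun i => `|V k i| ^+ 2)) //.
move=> L_neq0.
rewrite (big_inord_pred _ _ _ _ _ _ mu) // (big_inord_pred _ _ _ _ _ _ lam) //.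
rewrite (big_inord_pred _ _ _ _ _ _
  (fun i => (ev1 lam l - lam i) * (`|V k i| ^+ 2 / _))) //.
set I := [set i | _] in L_neq0 *.
set T := [set i : 'I_m.+2 | _]; set TJ := [set i : 'I_m.+1 | _].
set J := [set j : 'I_m.+1 | l <= j.+1 <= m.+1]%N.
have cTJ : #|TJ| = (r.+1 - l)%N by rewrite card_ord_range.
have cT : #|T| = (r.+1 - l)%N by rewrite card_ord_range.
have cIJ : ((r.+1 - l) + #|~: I| = #|J|)%N.
  by have := cardsC I; rewrite card_ord !card_ord_range //; lia.
have [p [q [pq [p0 sp pI p1] [q0 sq qJ q1]]]] :=
  common_compression_weights _ _ _ _ _ _ _ A_herm V_unitary V_eigen mu_char _ _ _ cIJ L_neq0.
(* The roles are reversed: the weights [q] now vanish before [l], and the threshold is [mu_r]. *)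
have muq : \sum_j mu j * q j <= \sum_(j in TJ) mu j.
  have := weighted_sum_le _ _ TJ mu q (fun=> 0) (ev1 mu r) q0.
  rewrite -mulr_suml mulr0 [\sum_(j in TJ) mu j - _]subr0; apply=> [j _||j|j].
  - by rewrite subr0.
  - by rewrite cTJ.
  - rewrite inE => jT; apply: (ev1_noninc _ _ _ _ mu_noninc _).2; lia.
  - rewrite inE => jT; case: (boolP (j \in J)) => [|/qJ]; last by left.
    rewrite inE => jJ; right; apply: (ev1_noninc _ _ _ _ mu_noninc _).1; lia.
apply: le_trans muq; rewrite -pq.
(* The threshold is [lam_l]; the index [l] itself lies outside [T] and meets it with equality. *)
apply: (weighted_sum_ge _ _ T lam p _ _ p0) => [i||i|i].
- by rewrite inE => iT; apply: p1; rewrite inE; lia.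
- by rewrite cT.
- rewrite inE => iT; apply: (ev1_noninc _ _ _ _ lam_noninc _).1; lia.
- rewrite inE => iT; case: (boolP (i \in I)) => [|/pI]; last by left.
  rewrite inE => iI; right; apply: (ev1_noninc _ _ _ _ lam_noninc _).2; lia.
Qed.

End EigenvalueSums.

(* n = m.+2 (so n >= 2); A_k = row' k (col' k A) : 'M_(m.+1). *)
Theorem theorem3p4 (C : numClosedFieldType) (m : nat)
  (A V : 'M[C]_m.+2) (lam : 'I_m.+2 -> C) (mu : 'I_m.+2 -> 'I_m.+1 -> C)
  (l r : nat) :
  A \is hermsymmx ->
  V ^t* *m V = 1%:M ->
  (forall i : 'I_m.+2, A *m col i V = lam i *: col i V) ->
  (forall i j : 'I_m.+2, (i <= j)%N -> lam j <= lam i) ->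
  (forall k : 'I_m.+2,
     char_poly (row' k (col' k A)) = \prod_(j < m.+1) ('X - (mu k j)%:P)) ->
  (forall (k : 'I_m.+2) (i j : 'I_m.+1), (i <= j)%N -> mu k j <= mu k i) ->
  (1 <= l)%N -> (l <= r)%N -> (r <= m.+1)%N ->
  (forall k : nat, (1 <= k <= m.+2)%N -> Uk V l k != 0) ->
  (forall k : nat, (1 <= k <= m.+2)%N -> Lk V r k != 0) ->
  (m.+2)%:R * (\sum_(l <= j < r.+1) ev1 lam j.+1)
    + \sum_(l <= j < r.+1) (ev1 lam l - ev1 lam j.+1) * Psi V r j.+1
  <= \sum_(1 <= k < m.+3) \sum_(l <= j < r.+1) ev1 (mu (inord k.-1)) j
  /\
  \sum_(1 <= k < m.+3) \sum_(l <= j < r.+1) ev1 (mu (inord k.-1)) j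
  <= (m.+2)%:R * (\sum_(l <= j < r.+1) ev1 lam j)
     - \sum_(l <= j < r.+1) (ev1 lam j - ev1 lam r.+1) * Omega V l j.
Proof.
move=> A_herm V_unitary V_eigen lam_noninc mu_char mu_noninc l_gt0 le_lr le_rm U_neq0 L_neq0.
have kE k : (1 <= k < m.+3)%N -> (inord k.-1 : 'I_m.+2).+1 = k.
  by move=> k_range; rewrite inordK; lia.
(* Both bounds are sums over [k] of the bounds for a single [k]: exchanging sums unfolds [Psi] and
   [Omega], and the terms free of [k] give the factor [n]. *)
split.
  have -> : \sum_(l <= j < r.+1) (ev1 lam l - ev1 lam j.+1) * Psi V r j.+1
      = \sum_(1 <= k < m.+3) \sum_(l <= j < r.+1) (ev1 lam l - ev1 lam j.+1)
          * (`|vc V j.+1 k| ^+ 2 / Lk V r k).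
    by rewrite exchange_big /=; apply: eq_bigr => j _; rewrite mulr_sumr.
  have -> : (m.+2)%:R * \sum_(l <= j < r.+1) ev1 lam j.+1
      = \sum_(1 <= k < m.+3) \sum_(l <= j < r.+1) ev1 lam j.+1.
    by rewrite sumr_const_nat subn1 mulr_natl.
  rewrite -big_split /=; apply: ler_sum_nat => k k_range.
  have := submx_eigenvalue_sum_ge _ _ _ _ (inord k.-1) l r A_herm V_unitary V_eigen
    lam_noninc (mu_char _) (mu_noninc _) l_gt0 le_lr le_rm.
  by rewrite kE //; apply; apply: L_neq0.
have -> : \sum_(l <= j < r.+1) (ev1 lam j - ev1 lam r.+1) * Omega V l j
    = \sum_(1 <= k < m.+3) \sum_(l <= j < r.+1) (ev1 lam j - ev1 lam r.+1)
        * (`|vc V j k| ^+ 2 / Uk V l k).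
  by rewrite exchange_big /=; apply: eq_bigr => j _; rewrite mulr_sumr.
have -> : (m.+2)%:R * \sum_(l <= j < r.+1) ev1 lam j
    = \sum_(1 <= k < m.+3) \sum_(l <= j < r.+1) ev1 lam j.
  by rewrite sumr_const_nat subn1 mulr_natl.
rewrite -sumrB /=; apply: ler_sum_nat => k k_range.
have := submx_eigenvalue_sum_le _ _ _ _ (inord k.-1) l r A_herm V_unitary V_eigen
  lam_noninc (mu_char _) (mu_noninc _) l_gt0 le_lr le_rm.
by rewrite kE //; apply; apply: U_neq0.
Qed.
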